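(* Let $r,n\ge1$ be integers and $a_0,\dots,a_r$ rational numbers with $a_i\ge0$ for $i\ge1$. Let $p=a_0+\sum_{i=1}^r a_i\binom{r}{i}$. Then \[\rho_{M(n,r,\mathbf a)}(E(K_n^r))=\min\Big\{L_{\mathbf a}(E(K_n^r)),\ \min(1,\max(0,p))\binom{n}{r}\Big\}.\]
   Context: $K_n^r$ is the complete $r$-uniform hypergraph on $[n]$; for $q\ge1$, $K_n^{r}(q)$ is the multihypergraph with edge set $\{(e,i): e\in E(K_n^r), i\in[q]\}$, and for an edge set $G\subseteq E(K_n^r)$, $G(q)=\{(e,i): e\in G, i\in[q]\}$. For $A\subseteq E(K_n^r(q))$, $\pi(A)=\{e:\exists i\ (e,i)\in A\}$ (for ordinary edge sets, $\pi(G)=G$). The $m$-shadow $\partial_m(F)$ of an edge set $F$ is the set of $m$-element sets contained in some edge of $F$. For real $b_0,\dots,b_r$, $L_{\mathbf b}(A)=b_0+\sum_{i=1}^r b_i|\partial_i(\pi(A))|$. For integers $b_i$ ($b_i\ge0$ for $i\ge1$), $M(n,r,q,\mathbf b)$ is the matroid on $E(K_n^r(q))$ with rank $\mathrm{rk}_N(A)=\max\{|B|: B\subseteq A,\ |C|\le L_{\mathbf b}(C)\ \forall\text{ non-empty }C\subseteq B\}$. For rational $\mathbf a$ as in the claim, let $q$ be the least positive integer with $qa_i\in\mathbb Z$ for all $i$, let $N=M(n,r,q,q\mathbf a)$, and define the count polymatroid $M(n,r,\mathbf a)$ on $E(K_n^r)$ by $\rho_{M(n,r,\mathbf a)}(G)=\mathrm{rk}_N(G(q))/q$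 for $G\subseteq E(K_n^r)$.
   Formalization: The displayed equation fails when L_a(E(K_n^r)) < 0 (e.g. n=r=1, a=(-1,0): the rank is 0 but the right side is -1); the formal theorem proves the equation whenever L_a(E(K_n^r)) ≥ 0 and proves that the rank is 0 when L_a(E(K_n^r)) < 0. *)

(* Defs.v *)
From HB Require Import structures.
From mathcomp Require Import all_boot all_order all_algebra.

Set Implicit Arguments.
Unset Strict Implicit.
Unset Printing Implicit Defensive.

Import Order.TTheory GRing.Theory Num.Theory.
Local Open Scope ring_scope.

(* A hypergraph on the vertex set 'I_n is given by its edge set
   {set {set 'I_n}}; a multihypergraph with at most q parallel copies of each
   edge is given by its edge set in {set {set 'I_n} * 'I_q}. *)

Definition Kedges (n r : nat) : {set {set 'I_n}} := [set e : {set 'I_n} | #|e| == r].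

Definition copies (n q : nat) (G : {set {set 'I_n}}) :
  {set {set 'I_n} * 'I_q} := setX G [set: 'I_q].

Definition proj_edges (n q : nat) (A : {set {set 'I_n} * 'I_q}) :
  {set {set 'I_n}} := [set x.1 | x in A].

Definition shadow (n m : nat) (F : {set {set 'I_n}}) : {set {set 'I_n}} :=
  [set s : {set 'I_n} | (#|s| == m) && [exists e in F, s \subset e]].

Definition Lcount (R : numDomainType) (n r : nat) (b : 'I_r.+1 -> R)
    (F : {set {set 'I_n}}) : R :=
  b ord0 + \sum_(i < r.+1 | (0 < i)%N) b i * #|shadow i F|%:R.

Definition count_indep (R : numDomainType) (n r q : nat) (b : 'I_r.+1 -> R)
    (B : {set {set 'I_n} * 'I_q}) : bool :=
  [forall C : {set {set 'I_n} * 'I_q},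
     (C \subset B) && (C != set0) ==>
       (#|C|%:R <= Lcount b (proj_edges C))].

(* The rank function of M(n, r, q, b), on subsets A of copies q (Kedges n r);
   it is the rank function of a matroid when the b i are integers and
   b i >= 0 for i >= 1. *)
Definition count_rank (R : numDomainType) (n r q : nat) (b : 'I_r.+1 -> R)
    (A : {set {set 'I_n} * 'I_q}) : nat :=
  (\max_(B : {set {set 'I_n} * 'I_q} | (B \subset A) && count_indep b B)
     #|B|)%N.

Definition clears_denoms (r : nat) (a : 'I_r.+1 -> rat) (q : nat) : bool :=
  (0 < q)%N && [forall i, (q%:R * a i) \is a Num.int].

Lemma clears_denoms_exists (r : nat) (a : 'I_r.+1 -> rat) :
  exists q, clears_denoms a q.
Proof.
exists (\prod_i `|denq (a i)|)%N; apply/andP; split.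
  by rewrite prodn_cond_gt0 // => i _; rewrite absz_gt0 denq_neq0.
apply/forallP => i; rewrite (bigD1 i) //= natrM mulrAC rpredM ?natr_int //.
by rewrite natr_absz gtr0_norm ?denq_gt0 // mulrC -numqE intr_int.
Qed.

Definition denom (r : nat) (a : 'I_r.+1 -> rat) : nat :=
  ex_minn (clears_denoms_exists a).

(* The rank function of the count polymatroid M(n, r, a), on subsets G of
   Kedges n r. *)
Definition count_rho (n r : nat) (a : 'I_r.+1 -> rat)
    (G : {set {set 'I_n}}) : rat :=
  let q := denom a in
  (count_rank (fun i => q%:R * a i) (copies q G))%:R / q%:R.

(* Main.v *)
Require Import Defs.
From mathcomp Require Import all_boot all_order all_algebra.
From mathcomp Require Import zify ring lra.
Import Order.TTheory GRing.Theory Num.Theory.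
Local Open Scope ring_scope.

(** Write [N = 'C(n, r)], [K] for the complete hypergraph and [p] for the value of
    [L] on one edge. A nonempty family [F] of [r]-sets has an [i]-shadow at least as
    large as the linear interpolation in [#|F|] between the cases [#|F| = 1] and
    [F = K], by double counting over vertex links. Since the coefficients [a i],
    [i >= 1], are nonnegative, [L F >= (#|F| / N) * min (L K) (N * p)]: the uniform
    vector of total weight [min (L K) (N * min 1 p)] obeys all the count constraints.
    As [L] is monotone, submodular and integral after scaling by [q], an independent
    set of maximum size is at least as large as any fractional solution, because its
    maximal tight subsets are disjoint and span everything outside it. *)

(** * Inequalities between binomial coefficients *)

(** For [j <= n] the growth ratio ['C(n.+1, j) / 'C(n, j)] is [(n + 1) / (n + 1 - j)], which
    increases with [j]. *)
Lemma leq_bin_ratio (n j s : nat) : (j <= s)%N ->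
  ('C(n.+1, j) * 'C(n, s) <= 'C(n.+1, s) * 'C(n, j))%N.
Proof.
move=> js; rewrite -(leq_pmul2l (ltn0Sn n)).
rewrite mulnCA [leqRHS]mulnCA (mul_bin_down n.+1 s) (mul_bin_down n.+1 j).
rewrite mulnCA [leqRHS]mulnCA [('C(n.+1, s) * _)%N]mulnC.
by rewrite leq_mul2r leq_sub2l ?orbT.
Qed.

(** Every [j]-set lies in some [s]-set; the induction on [m] compares growth ratios instead. *)
Lemma leq_bin_mul (m s j : nat) : (j <= s <= m)%N ->
  ('C(m, j) <= 'C(s, j) * 'C(m, s))%N.
Proof.
move=> /andP[js]; elim: m => [|m IH].
  by rewrite leqn0 => /eqP->; rewrite bin0 muln1.
rewrite leq_eqVlt => /orP[/eqP->|sm]; first by rewrite binn muln1.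
rewrite -(@leq_pmul2r 'C(m, s)) ?bin_gt0 //.
apply: leq_trans (leq_bin_ratio m _ _ js) _.
rewrite mulnAC [leqRHS]mulnC; apply: leq_mul => //; exact: IH.
Qed.

(* Junk value: the slope is [0] when ['C(m, r) = 1]. *)
Definition shadow_slope (m r i : nat) : rat :=
  ('C(m, i)%:R - 'C(r, i)%:R) / ('C(m, r)%:R - 1).

(** Concavity: as [m] grows, the points with coordinates ['C(m, s.+1)], ['C(m, j.+1)] start at [1],
    ['C(s.+1, j.+1)]. By Pascal's rule the next step has slope ['C(m, j) / 'C(m, s)], at most that
    of the chord so far. *)
Lemma bin_secant (m s j : nat) : (j <= s < m)%N ->
  'C(m, j)%:R * ('C(m, s.+1)%:R - 1) <=
  'C(m, s)%:R * ('C(m, j.+1)%:R - 'C(s.+1, j.+1)%:R) :> rat.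
Proof.
move=> /andP[js]; elim: m => // m IH; rewrite ltnS leq_eqVlt => /orP[/eqP<-|sm].
  by rewrite binn !subrr !mulr0.
have {IH} := IH sm.
rewrite (binS m s) (binS m j) (natrD _ 'C(m, s.+1)) (natrD _ 'C(m, j.+1)).
have := leq_bin_ratio m _ _ js; rewrite -(ler_nat rat) !natrM.
have xp : 0 <= 'C(m, j)%:R :> rat by rewrite ler0n.
have yp : 0 < 'C(m, s)%:R :> rat by rewrite ltr0n bin_gt0 ltnW.
have x'p : 0 <= 'C(m.+1, j)%:R :> rat by rewrite ler0n.
have y'p : 0 <= 'C(m.+1, s)%:R :> rat by rewrite ler0n.
have Yp : 0 <= 'C(m, s.+1)%:R - 1 :> rat by rewrite subr_ge0 ler1n bin_gt0.
set x := 'C(m, j)%:R in xp *; set y := 'C(m, s)%:R in yp *.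
set x' := 'C(m.+1, j)%:R in x'p *; set y' := 'C(m.+1, s)%:R in y'p *.
set Y := 'C(m, s.+1)%:R in Yp *; set X := 'C(m, j.+1)%:R; set c := 'C(s.+1, j.+1)%:R.
move=> h IH.
(* The Pascal increments [y] and [x] are already compared by [h]. *)
suff : x' * (Y - 1) <= y' * (X - c) by nra.
rewrite -(ler_pM2l yp).
have h1 : 0 <= (y' * x - x' * y) * (Y - 1) by rewrite mulr_ge0 // subr_ge0.
have h2 : 0 <= y' * (y * (X - c) - x * (Y - 1)) by rewrite mulr_ge0 // subr_ge0.
by nra.
Qed.

Lemma bin_gt1 (m r : nat) : (0 < r < m)%N -> (1 < 'C(m, r))%N.
Proof.
case: m r => [|m] [|r] //= rm; rewrite binS.
have: (0 < 'C(m, r.+1))%N by rewrite bin_gt0; lia.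
have: (0 < 'C(m, r))%N by rewrite bin_gt0; lia.
lia.
Qed.

(** By [bin_secant], each step extends the chord by a segment that is no steeper. *)
Lemma shadow_slope_decr (m m' s j : nat) : (j <= s)%N -> (s.+1 < m <= m')%N ->
  shadow_slope m' s.+1 j.+1 <= shadow_slope m s.+1 j.+1.
Proof.
move=> js /andP[sm]; elim: m' => [|m' IH]; first lia.
rewrite leq_eqVlt => /orP[/eqP->//|mm']; apply: le_trans (IH mm').
have c1 : 0 < 'C(m', s.+1)%:R - 1 :> rat.
  by rewrite subr_gt0 ltr1n bin_gt1 //; lia.
have c2 : 0 < 'C(m'.+1, s.+1)%:R - 1 :> rat.
  by rewrite subr_gt0 ltr1n bin_gt1 //; lia.
rewrite /shadow_slope ler_pdivrMr // mulrAC ler_pdivlMr //.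
have := @bin_secant m' s j; rewrite !binS !natrD => /(_ ltac:(lia)).
by nra.
Qed.

Lemma shadow_slope_le (m s j : nat) : (j <= s <= m)%N ->
  shadow_slope m s j <= 'C(s, j)%:R.
Proof.
move=> jsm; have := leq_bin_mul _ _ _ jsm.
rewrite -(ler_nat rat) natrM /shadow_slope.
have [C1|C1] := leqP 'C(m, s) 1.
  have -> : 'C(m, s) = 1%N.
    apply/eqP; rewrite eqn_leq C1 bin_gt0; lia.
  by rewrite subrr invr0 mulr0 ler0n.
have c1 : 0 < 'C(m, s)%:R - 1 :> rat by rewrite subr_gt0 ltr1n.
by rewrite ler_pdivrMr //; nra.
Qed.

(** * Vertex links and shadows *)

Section Links.
Variable n : nat.
Implicit Types (F G : {set {set 'I_n}}) (v : 'I_n).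

Definition link v F : {set {set 'I_n}} :=
  [set e : {set 'I_n} | (v \notin e) && (v |: e \in F)].

Lemma card_link v F : #|link v F| = #|[set e : {set 'I_n} in F | v \in e]|.
Proof.
rewrite -(@card_in_imset _ _ (fun e : {set 'I_n} => v |: e) (link v F)).
  apply: eq_card => e; rewrite !inE; apply/imsetP/andP.
    by case=> e' + ->; rewrite inE => /andP[_ ->]; rewrite setU11.
  case=> eF ve; exists (e :\ v); last by rewrite setD1K.
  by rewrite inE !inE eqxx /= setD1K.
move=> e e'; rewrite !inE => /andP[ve _] /andP[ve' _] /(congr1 (fun s : {set 'I_n} => s :\ v)).
by rewrite !setU1K.
Qed.

Lemma sum_card_link F r : F \subset Kedges n r ->
  (\sum_v #|link v F| = r * #|F|)%N.
Proof.
move=> /subsetP Fr; under eq_bigr do rewrite card_link -sum1_card.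
rewrite (exchange_big_dep (mem F)) /=; last by move=> v e _; rewrite inE => /andP[].
rewrite mulnC -sum_nat_const; apply: eq_bigr => e eF.
rewrite sum1dep_card; have := Fr e eF; rewrite inE => /eqP <-.
by apply: eq_card => v; rewrite !inE eF.
Qed.

(** Lets an induction on the uniformity pass to links: summed over [v], these sizes count each set
    of [shadow i.+1 F] exactly [i.+1] times. *)
Lemma link_shadow v F i : link v (shadow i.+1 F) = shadow i (link v F).
Proof.
apply/setP => s; rewrite !inE; apply/and3P/andP.
  case=> vs; rewrite cardsU1 vs add1n eqSS => -> /existsP[e /andP[eF sub]].
  split=> //; apply/existsP; exists (e :\ v).
  rewrite !inE eqxx /= setD1K ?eF //=; last by rewrite (subsetP sub) ?setU11.
  apply/subsetP => x xs; rewrite !inE (subsetP sub) ?setU1r // andbT.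
  by apply: contraNneq vs => <-.
case=> /eqP<- /existsP[e]; rewrite inE => /andP[/andP[ve eF] sub].
have vs : v \notin s by apply: contraNN ve; apply: (subsetP sub).
split=> //; first by rewrite cardsU1 vs.
by apply/existsP; exists (v |: e); rewrite eF setUS.
Qed.

Lemma shadow_Kedges F i : shadow i F \subset Kedges n i.
Proof. by apply/subsetP => s; rewrite !inE => /andP[]. Qed.

Lemma link_Kedges v F r : F \subset Kedges n r.+1 -> link v F \subset Kedges n r.
Proof.
move=> /subsetP Fr; apply/subsetP => e; rewrite inE => /andP[ve /Fr].
by rewrite !inE cardsU1 ve.
Qed.

Lemma cover_link v F : cover (link v F) \subset cover F :\ v.
Proof.
apply/subsetP => x /bigcupP[e]; rewrite inE => /andP[ve eF] xe.
rewrite !inE; apply/andP; split; first by apply: contraNneq ve => <-.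
by apply/bigcupP; exists (v |: e) => //; rewrite setU1r.
Qed.

Lemma link_neq0 v F : (link v F != set0) = (v \in cover F).
Proof.
apply/set0Pn/bigcupP.
  by case=> e; rewrite inE => /andP[_ eF]; exists (v |: e) => //; rewrite setU11.
by case=> e eF ve; exists (e :\ v); rewrite !inE eqxx setD1K.
Qed.

Lemma card_cover_bin F r : F \subset Kedges n r -> (#|F| <= 'C(#|cover F|, r))%N.
Proof.
move=> Fr; rewrite -cards_draws subset_leq_card //; apply/subsetP => e eF.
by have := subsetP Fr e eF; rewrite !inE => ->; rewrite andbT (bigcup_sup e).
Qed.

Lemma card_shadow1 (e : {set 'I_n}) i : #|shadow i [set e]| = 'C(#|e|, i).
Proof.
rewrite -cards_draws; apply: eq_card => s; rewrite !inE andbC; congr (_ && _).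
apply/existsP/idP => [[e']|se]; first by rewrite inE => /andP[/eqP->].
by exists e; rewrite inE eqxx.
Qed.

Lemma shadow_mono i F G : F \subset G -> shadow i F \subset shadow i G.
Proof.
move=> /subsetP FG; apply/subsetP => s; rewrite !inE => /andP[-> /existsP[e]].
by case/andP=> /FG eG se; apply/existsP; exists e; rewrite eG.
Qed.

(** * Interpolation bound for shadows *)

Lemma shadow_interp0 r F m : F != set0 ->
  'C(r, 0)%:R + (#|F|%:R - 1) * shadow_slope m r 0 <= #|shadow 0 F|%:R.
Proof.
rewrite /shadow_slope !bin0 subrr !mul0r mulr0 addr0 ler1n card_gt0.
move=> /set0Pn[e eF]; apply/set0Pn; exists set0; rewrite !inE cards0 eqxx /=.
by apply/existsP; exists e; rewrite eF sub0set.
Qed.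

(* With [d = #|cover F|], summing the induction hypothesis over the [d] nonempty
   links gives a bound that is affine in [#|F|], exact at [#|F| = 'C(d, r)] and
   no smaller than the required one at [#|F| = 1]. *)
Lemma shadow_interp r i F (m : nat) : (i <= r)%N -> F != set0 ->
  F \subset Kedges n r -> (#|cover F| <= m)%N ->
  'C(r, i)%:R + (#|F|%:R - 1) * shadow_slope m r i <= #|shadow i F|%:R.
Proof.
elim: r i F m => [|r IH] i F m ir F0 Fr Fm.
  by move: ir; rewrite leqn0 => /eqP->; apply: shadow_interp0.
case: i ir => [|i] ir; first exact: shadow_interp0.
rewrite ltnS in ir.
have Fgt0 : (0 < #|F|)%N by rewrite card_gt0.
have [/cards1P[e Fe]|F1] := boolP (#|F| == 1)%N.
  have := subsetP Fr e; rewrite Fe cards1 subrr mul0r addr0 set11 inE => /(_ isT)/eqP<-.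
  by rewrite card_shadow1.
have Fle := card_cover_bin _ _ Fr.
set d := #|cover F| in Fm Fle.
(* At least two edges are present, while [d <= r.+1] would allow only one. *)
have rd : (r.+1 < d)%N.
  rewrite ltnNge; apply/negP; rewrite leq_eqVlt => /orP[/eqP dr|dr].
    by move: Fle; rewrite dr binn; lia.
  by move: Fle; rewrite bin_small; lia.
(* Slopes decrease with the ground set, so the covered vertices alone give the stronger bound. *)
apply: (@le_trans _ _ ('C(r.+1, i.+1)%:R + (#|F|%:R - 1) * shadow_slope d r.+1 i.+1)).
  rewrite lerD2l ler_wpM2l ?subr_ge0 ?ler1n //.
  by apply: shadow_slope_decr => //; rewrite rd.
(* The link at [v] avoids [v], hence covers at most [d.-1] vertices. *)
set k := shadow_slope d.-1 r i.
have sumb : d%:R * 'C(r, i)%:R + (r.+1%:R * #|F|%:R - d%:R) * k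
    <= i.+1%:R * #|shadow i.+1 F|%:R.
  rewrite -!natrM -(sum_card_link _ _ Fr) -(sum_card_link _ _ (shadow_Kedges F i.+1)).
  have -> : (\sum_v #|link v F| = \sum_(v in cover F) #|link v F|)%N.
    rewrite [RHS]big_mkcond; apply: eq_bigr => v _; case: ifPn => //.
    by rewrite -link_neq0 negbK => /eqP->; rewrite cards0.
  apply: (@le_trans _ _ (\sum_(v in cover F) #|shadow i (link v F)|%:R)); last first.
    rewrite natr_sum big_mkcond; apply: ler_sum => v _; rewrite link_shadow.
    by case: ifP.
  rewrite natr_sum natrM.
  have -> : d%:R = \sum_(v in cover F) 1 :> rat by rewrite sumr_const.
  rewrite mulr_suml -sumrB mulr_suml -big_split /=; apply: ler_sum => v vF.
  rewrite mul1r; apply: IH => //; first by rewrite link_neq0.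
    exact: link_Kedges.
  apply: leq_trans (subset_leq_card (cover_link v F)) _.
  by rewrite /d (cardsD1 v (cover F)) vF.
have kle : k <= 'C(r, i)%:R by apply: shadow_slope_le; lia.
have kE : k * ('C(d.-1, r)%:R - 1) = 'C(d.-1, i)%:R - 'C(r, i)%:R.
  (* For [r = 0] the slope is the junk [0], but then [i = 0] and the right side vanishes too. *)
  rewrite /k /shadow_slope; have [r0|r0] := posnP r.
    have -> : i = 0%N by lia.
    by rewrite r0 !bin0 !subrr mulr0.
  by rewrite divfK // subr_eq0 pnatr_eq1 neq_ltn bin_gt1 ?orbT //; lia.
set t := shadow_slope d r.+1 i.+1.
have tE : t * ('C(d, r.+1)%:R - 1) = 'C(d, i.+1)%:R - 'C(r.+1, i.+1)%:R.
  by rewrite divfK // subr_eq0 pnatr_eq1 neq_ltn bin_gt1 ?orbT //; lia.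
have e1 : d%:R * 'C(d.-1, r)%:R = r.+1%:R * 'C(d, r.+1)%:R :> rat.
  by rewrite -!natrM mul_bin_diag.
have e2 : d%:R * 'C(d.-1, i)%:R = i.+1%:R * 'C(d, i.+1)%:R :> rat.
  by rewrite -!natrM mul_bin_diag.
have e3 : r.+1%:R * 'C(r, i)%:R = i.+1%:R * 'C(r.+1, i.+1)%:R :> rat.
  by rewrite -!natrM (mul_bin_diag r.+1).
have Fle' : #|F|%:R <= 'C(d, r.+1)%:R :> rat by rewrite ler_nat.
have rd' : r.+1%:R <= d%:R :> rat by rewrite ler_nat ltnW.
have F1' : 1 <= #|F|%:R :> rat by rewrite ler1n.
have N1 : 0 < 'C(d, r.+1)%:R - 1 :> rat.
  by rewrite subr_gt0 ltr1n bin_gt1 //; lia.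
(* Both sides are the excess, at [#|F| = 1], of the summed bound over [i.+1] times the required one:
   on the left measured back from [#|F| = 'C(d, r.+1)], on the right computed directly. *)
have endpoint : ('C(d, r.+1)%:R - 1) * (i.+1%:R * t - r.+1%:R * k)
    = (d%:R - r.+1%:R) * ('C(r, i)%:R - k).
  have -> : ('C(d, r.+1)%:R - 1) * (i.+1%:R * t - r.+1%:R * k) =
     i.+1%:R * (t * ('C(d, r.+1)%:R - 1)) - (r.+1%:R * 'C(d, r.+1)%:R) * k
     + r.+1%:R * k by ring.
  rewrite tE -e1 mulrBr -e2 -e3.
  have -> : d%:R * 'C(d.-1, r)%:R * k = d%:R * (k * ('C(d.-1, r)%:R - 1)) + d%:R * k
    by ring.
  by rewrite kE; ring.
have ge0 : 0 <= i.+1%:R * t - r.+1%:R * k.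
  by rewrite -(pmulr_rge0 _ N1) endpoint mulr_ge0 // subr_ge0.
rewrite -(ler_pM2l (ltr0Sn rat i)); apply: le_trans sumb.
have : 0 <= ('C(d, r.+1)%:R - #|F|%:R) * (i.+1%:R * t - r.+1%:R * k).
  by rewrite mulr_ge0 // subr_ge0.
by nra.
Qed.
End Links.

(** * Maximal sets under an integral submodular bound *)

Section MaximalIndependent.
Variables (E : finType) (f : {set E} -> rat).
Implicit Types (A B C T U : {set E}) (e : E).

(** Abstract form of [count_indep], with [f C] in place of [Lcount b (proj_edges C)]. The empty set
    is exempt because [f set0] may be negative. *)
Definition bounded_by B : bool :=
  [forall C : {set E}, (C \subset B) && (C != set0) ==> (#|C|%:R <= f C)].

Hypothesis f_int : forall C, f C \is a Num.int.
Hypothesis f_mono : forall A B, A \subset B -> f A <= f B.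
Hypothesis f_submod : forall A B, f (A :|: B) + f (A :&: B) <= f A + f B.

Lemma bounded_byP B :
  reflect (forall C, C \subset B -> C != set0 -> #|C|%:R <= f C) (bounded_by B).
Proof.
apply: (iffP forallP) => [h C CB C0|h C]; first by have := h C; rewrite CB C0.
by apply/implyP => /andP[]; apply: h.
Qed.

Definition tight B T : bool := [&& T \subset B, T != set0 & f T == #|T|%:R].

(** Uncrossing: the lower bound on [f (T :&: U)] is available only for a nonempty intersection. *)
Lemma tightU B T U : bounded_by B -> tight B T -> tight B U ->
  T :&: U != set0 -> tight B (T :|: U).
Proof.
move=> /bounded_byP Bf /and3P[TB T0 /eqP fT] /and3P[UB U0 /eqP fU] TU0.
have TUB : T :|: U \subset B by rewrite subUset TB.
have TUn0 : T :|: U != set0 by rewrite setU_eq0 negb_and T0.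
rewrite /tight TUB TUn0 /= eq_le Bf // andbT.
have := f_submod T U; rewrite fT fU -natrD -cardsUI natrD.
have := Bf _ (subset_trans (subsetIl T U) TB) TU0.
by lra.
Qed.

(** Elements are added one at a time: [x |: T] and [T :|: X'] meet in a superset of [T], so
    submodularity keeps the value from rising. *)
Lemma span_setU T (X : {set E}) : {in X, forall e, f (e |: T) <= f T} ->
  f (T :|: X) <= f T.
Proof.
have [k] := ubnP #|X|; elim: k X => // k IHk X Xk spanX.
have [->|[x xX]] := set_0Vmem X; first by rewrite setU0.
move: Xk spanX; rewrite -(setD1K xX); set X' := X :\ x; rewrite cardsU1 => Xk spanX.
have IH := IHk X' (ltac:(by move: Xk; rewrite !inE eqxx; lia)).
have := IH (fun e eX => spanX e (setU1r _ eX)).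
have := spanX x (setU11 _ _).
have := f_submod (x |: T) (T :|: X').
have := f_mono T ((x |: T) :&: (T :|: X')).
rewrite subsetI subsetUr subsetUl => /(_ isT).
have -> : (x |: T) :|: (T :|: X') = T :|: (x |: X').
  by rewrite -setUA (setUA T) setUid setUCA.
by lra.
Qed.

(* Every element outside a maximal [B] is spanned by a tight subset of [B], and
   the maximal tight subsets of [B] are disjoint, so that [A] is covered by the
   rest of [B] and the spans of these tight subsets. *)
Lemma maximal_bounded_card A B (c : rat) : 0 <= c <= 1 ->
  {in A, forall e, 1 <= f [set e]} ->
  (forall C, C \subset A -> C != set0 -> c * #|C|%:R <= f C) ->
  B \subset A -> bounded_by B ->
  {in A :\: B, forall e, ~~ bounded_by (e |: B)} ->
  c * #|A|%:R <= #|B|%:R.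
Proof.
move=> /andP[c0 c1] f1 cf BA Bf Bmax.
pose P := [set T | maxset (tight B) T].
have Ptight T : T \in P -> tight B T by rewrite inE => /maxsetp.
have Pmax T U : T \in P -> tight B U -> T :&: U != set0 -> U \subset T.
  move=> TP tU TU0; have := TP; rewrite inE => /maxsetP[tT mT].
  by rewrite -(mT (T :|: U)) ?subsetUr ?subsetUl // tightU.
have trivP : trivIset P.
  apply/trivIsetP => T U TP UP; apply: contraR; rewrite -setI_eq0 => TU0.
  by rewrite eqEsubset !Pmax ?Ptight // setIC.
have coverP : cover P \subset B.
  by apply/bigcupsP => T /Ptight /and3P[].
pose span T := T :|: [set e in A | f (e |: T) <= f T].
have spanP e : e \in A :\: B -> exists2 T, T \in P & e \in span T.
  move=> eAB; have := Bmax e eAB; rewrite inE in eAB; have /andP[eB eA] := eAB.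
  rewrite negb_forall => /existsP[C]; rewrite negb_imply -ltNge.
  case/andP=> /andP[CB C0] Cf.
  have eC : e \in C.
    apply: contraLR Cf => eC; rewrite -leNgt; move/bounded_byP: Bf; apply=> //.
    apply/subsetP => x xC; have := subsetP CB x xC; rewrite !inE => /orP[/eqP xe|//].
    by rewrite -xe xC in eC.
  pose T := C :\ e.
  have CE : C = e |: T by rewrite setD1K.
  (* Integrality turns the strict violation at [C] into a gap of a whole unit, the one contributed
     by [e]. *)
  have fC : f C <= #|T|%:R.
    have /intrP[z fz] := f_int C; move: Cf; rewrite fz (cardsD1 e) eC.
    rewrite -[(_ + _)%:R]/((Posz (1 + #|T|))%:~R) -[#|T|%:R]/((Posz #|T|)%:~R).
    by rewrite ltr_int ler_int; lia.
  have T0 : T != set0.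
    apply/negP => /eqP T0; move: fC; rewrite CE T0 setU0 cards0.
    by have := f1 e eA; lra.
  have TB : T \subset B by rewrite subDset.
  have tT : tight B T.
    rewrite /tight TB T0 /= eq_le (bounded_byP _ Bf) // andbT.
    by apply: le_trans fC; rewrite f_mono // CE subsetUr.
  have [U mU TU] := maxset_exists tT; exists U; first by rewrite inE.
  rewrite !inE eA /=; apply/orP; right.
  (* Since [f C <= f T <= f (U :&: C)], submodularity transfers the spanning of [e] from [T] to
     [U]. *)
  have := f_submod U C; rewrite {1}CE setUCA (setUidPl TU).
  have := f_mono T (U :&: C); rewrite subsetI TU subsetDl => /(_ isT).
  have /and3P[_ _ /eqP->] := tT.
  by lra.
(* The lower bound on [f] at the span meets [f (span T) <= f T = #|T|]. *)
have cspan T : T \in P -> c * #|span T|%:R <= #|T|%:R.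
  move=> /Ptight /and3P[TB T0 /eqP <-].
  have sA : span T \subset A.
    by rewrite subUset (subset_trans TB BA); apply/subsetP => e; rewrite inE => /andP[].
  apply: le_trans (cf _ sA _) _; first by rewrite setU_eq0 negb_and T0.
  by apply: span_setU => e; rewrite inE => /andP[].
have sub : A \subset (B :\: cover P) :|: \bigcup_(T in P) span T.
  apply/subsetP => e eA; rewrite inE; have [eB|eB] := boolP (e \in B).
    rewrite inE eB andbT; have [/bigcupP[T TP eT]|//] := boolP (e \in cover P).
    by apply/bigcupP; exists T => //; rewrite inE eT.
  have [|T TP eT] := spanP e; first by rewrite inE eB.
  by apply/orP; right; apply/bigcupP; exists T.
have cardA : (#|A| <= #|B :\: cover P| + \sum_(T in P) #|span T|)%N.
  apply: leq_trans (subset_leq_card sub) _.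
  apply: leq_trans (leq_card_setU _ _) _; rewrite leq_add2l.
  elim/big_rec2: _ => [|T m X _ h]; first by rewrite cards0.
  by apply: leq_trans (leq_card_setU _ _) _; rewrite leq_add2l.
have cardB : #|B| = (#|B :\: cover P| + \sum_(T in P) #|T|)%N.
  by rewrite -(cardsID (cover P) B) (setIidPr coverP) addnC (eqP trivP).
(* Elements of [B] outside all tight sets are paid for by [c <= 1], the spans by [cspan]. *)
apply: (@le_trans _ _ (c * (#|B :\: cover P| + \sum_(T in P) #|span T|)%:R)).
  by rewrite ler_wpM2l // ler_nat.
rewrite cardB !natrD mulrDr lerD ?ler_piMl // !natr_sum mulr_sumr.
exact: ler_sum.
Qed.
End MaximalIndependent.

(** * The count function and the rank of the complete hypergraph *)

Section CountFunction.
Variables (n r : nat) (b : 'I_r.+1 -> rat).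
Hypothesis b_ge0 : forall i : 'I_r.+1, (1 <= i)%N -> 0 <= b i.
Implicit Types (F G : {set {set 'I_n}}).

Let edge_count : rat := b ord0 + \sum_(i < r.+1 | (0 < i)%N) b i * 'C(r, i)%:R.

Lemma Lcount_mono F G : F \subset G -> Lcount b F <= Lcount b G.
Proof.
move=> FG; rewrite lerD2l; apply: ler_sum => i i0.
by rewrite ler_wpM2l ?b_ge0 // ler_nat subset_leq_card // shadow_mono.
Qed.

(** The shadow of a union is the union of the shadows, and that of an intersection lies in both. *)
Lemma Lcount_submod F G :
  Lcount b (F :|: G) + Lcount b (F :&: G) <= Lcount b F + Lcount b G.
Proof.
rewrite /Lcount addrACA [leRHS]addrACA lerD2l -!big_split /=.
apply: ler_sum => i i0; rewrite -!mulrDr ler_wpM2l ?b_ge0 // -!natrD ler_nat.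
rewrite -[leqRHS]cardsUI leq_add // subset_leq_card //.
  apply/subsetP => s; rewrite !inE => /andP[-> /existsP[e]]; rewrite inE.
  by case/andP=> /orP[] eF se; apply/orP; [left|right]; apply/existsP; exists e;
     rewrite eF.
by rewrite subsetI !shadow_mono ?subsetIl ?subsetIr.
Qed.

Lemma Lcount_int F : (forall i, b i \is a Num.int) -> Lcount b F \is a Num.int.
Proof.
move=> bint; rewrite rpredD ?bint // rpred_sum // => i _.
by rewrite rpredM ?bint // natr_int.
Qed.

Lemma Lcount_edge (e : {set 'I_n}) : e \in Kedges n r ->
  Lcount b [set e] = edge_count.
Proof.
rewrite inE => /eqP er; congr (_ + _); apply: eq_bigr => i _.
by rewrite card_shadow1 er.
Qed.

Lemma card_Kedges k : #|Kedges n k| = 'C(n, k).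
Proof. by rewrite card_draws card_ord. Qed.

(** With [s = (#|F| - 1) / (N - 1)], the shadow bounds give [L F >= (1 - s) * edge_count + s * L K],
    hence at least [((1 - s) / N + s) * m = #|F| * m / N]. *)
Lemma Lcount_lower F m : F != set0 -> F \subset Kedges n r ->
  m <= Lcount b (Kedges n r) -> m <= 'C(n, r)%:R * edge_count ->
  #|F|%:R * m <= 'C(n, r)%:R * Lcount b F.
Proof.
move=> F0 Fr mK mp.
have F1 : (0 < #|F|)%N by rewrite card_gt0.
have FN : (#|F| <= 'C(n, r))%N by rewrite -card_Kedges subset_leq_card.
(* Here [s] would have denominator [0], but [F] is all of [K]. *)
have [N1|N1] := leqP 'C(n, r) 1.
  have FK : F = Kedges n r.
    by apply/eqP; rewrite eqEcard Fr card_Kedges; lia.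
  by rewrite FK card_Kedges ler_wpM2l ?ler0n.
have N1' : 0 < 'C(n, r)%:R - 1 :> rat by rewrite subr_gt0 ltr1n.
have {F1}F1' : 1 <= #|F|%:R :> rat by rewrite ler1n.
have {FN}FN' : #|F|%:R <= 'C(n, r)%:R :> rat by rewrite ler_nat.
set N := 'C(n, r)%:R in mp N1' FN' *.
pose s := (#|F|%:R - 1) / (N - 1).
have sE : s * (N - 1) = #|F|%:R - 1 by rewrite divfK // gt_eqF.
have s0 : 0 <= s by rewrite divr_ge0 //; lra.
have s1 : s <= 1 by rewrite ler_pdivrMr // mul1r lerD2r.
have interp : (1 - s) * edge_count + s * Lcount b (Kedges n r) <= Lcount b F.
  rewrite /edge_count /Lcount !mulrDr addrACA -mulrDl subrK mul1r lerD2l.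
  rewrite !mulr_sumr -big_split /=; apply: ler_sum => i i0.
  rewrite mulrCA (mulrCA s) -mulrDr ler_wpM2l ?b_ge0 //.
  have ir : (i <= r)%N by rewrite -ltnS.
  have Fn : (#|cover F| <= n)%N by rewrite -[leqRHS]card_ord max_card.
  apply: le_trans (shadow_interp _ _ _ _ _ ir F0 Fr Fn).
  have -> : (#|F|%:R - 1) * shadow_slope n r i = s * ('C(n, i)%:R - 'C(r, i)%:R).
    by rewrite /shadow_slope /s -/N mulrA mulrAC.
  have : #|shadow i (Kedges n r)|%:R <= 'C(n, i)%:R :> rat.
    by rewrite ler_nat -card_Kedges subset_leq_card // shadow_Kedges.
  by nra.
have N0 : 0 <= N by lra.
have h1 : 0 <= (1 - s) * (N * edge_count - m) by rewrite mulr_ge0 ?subr_ge0.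
have h2 : 0 <= N * s * (Lcount b (Kedges n r) - m).
  by apply: mulr_ge0; [apply: mulr_ge0 | rewrite subr_ge0].
have h3 : N * ((1 - s) * edge_count + s * Lcount b (Kedges n r)) <= N * Lcount b F.
  by rewrite ler_wpM2l.
have -> : #|F|%:R = s * (N - 1) + 1 by rewrite sE subrK.
by nra.
Qed.

Variable q : nat.
Implicit Types (A B C : {set {set 'I_n} * 'I_q}).

Lemma count_indep0 : count_indep b (set0 : {set {set 'I_n} * 'I_q}).
Proof.
by apply/forallP => C; rewrite subset0; apply/implyP => /andP[->].
Qed.

(** A set attaining the maximum cardinality is also maximal for inclusion, as [maximal_bounded_card]
    requires. *)
Lemma count_rank_witness A : exists B,
  [/\ B \subset A, count_indep b B, count_rank b A = #|B|
    & {in A :\: B, forall x, ~~ count_indep b (x |: B)}].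
Proof.
pose P := [pred B : {set {set 'I_n} * 'I_q} | (B \subset A) && count_indep b B].
have P0 : P set0 by rewrite /= sub0set count_indep0.
have [|B] := @eq_bigmax_cond _ P (fun B => #|B|).
  by apply/card_gt0P; exists set0.
rewrite -topredE /= => /andP[BA Bi] rkE; exists B; split=> //.
move=> x; rewrite inE => /andP[xB xA]; apply/negP => xBi.
have := @leq_bigmax_cond _ P (fun B => #|B|) (x |: B).
rewrite /= xBi subUset sub1set xA BA => /(_ isT).
by move: rkE => /= ->; rewrite cardsU1 xB ltnn.
Qed.

Lemma proj_edges1 (x : {set 'I_n} * 'I_q) : proj_edges [set x] = [set x.1].
Proof. exact: imset_set1. Qed.

Lemma proj_edges_sub A G : A \subset copies q G -> proj_edges A \subset G.
Proof.
move=> /subsetP AG; apply/subsetP => e /imsetP[x /AG + ->].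
by rewrite inE => /andP[].
Qed.

Lemma count_rank_eq0 : (n < r)%N \/ edge_count < 1 ->
  count_rank b (copies q (Kedges n r)) = 0%N.
Proof.
move=> small; have [B [BA /forallP Bi -> _]] := count_rank_witness (copies q (Kedges n r)).
apply/eqP; rewrite cards_eq0; apply/negPn/negP => /set0Pn[x xB].
have := subsetP BA x xB; rewrite inE => /andP[xK _].
have := Bi [set x]; rewrite sub1set xB -card_gt0 cards1 /= proj_edges1 Lcount_edge //.
case: small => [nr|small]; last by rewrite leNgt small.
have : (0 < #|Kedges n r|)%N by apply/card_gt0P; exists x.1.
by rewrite card_Kedges bin_small.
Qed.

Lemma count_rank_Kedges : (forall i, b i \is a Num.int) -> (0 < q)%N ->
  (r <= n)%N -> 1 <= edge_count ->
  (count_rank b (copies q (Kedges n r)))%:R =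
  Num.min (Lcount b (Kedges n r)) (Num.min q%:R edge_count * 'C(n, r)%:R).
Proof.
move=> bint q0 rn p1; set K := Kedges n r; set A := copies q K.
have [B [BA Bi -> Bmax]] := count_rank_witness A.
have Bf : forall C, C \subset B -> C != set0 -> #|C|%:R <= Lcount b (proj_edges C).
  by move=> C CB C0; have /forallP/(_ C) := Bi; rewrite CB C0.
have N0 : 0 < 'C(n, r)%:R :> rat by rewrite ltr0n bin_gt0.
have q0' : 0 < q%:R :> rat by rewrite ltr0n.
have K0 : (0 < #|K|)%N by rewrite card_Kedges bin_gt0.
have LK : edge_count <= Lcount b K.
  by have /card_gt0P[e eK] := K0; rewrite -(Lcount_edge e eK) Lcount_mono ?sub1set.
set M := Num.min _ _.
have MK : M <= Lcount b K by rewrite ge_min lexx.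
have Mq : M <= q%:R * 'C(n, r)%:R.
  by rewrite ge_min; apply/orP; right; rewrite ler_pM2r // ge_min lexx.
have Mp : M <= 'C(n, r)%:R * edge_count.
  by rewrite mulrC ge_min; apply/orP; right; rewrite ler_pM2r // ge_min lexx orbT.
have M0 : 0 <= M.
  by rewrite le_min (le_trans _ LK) ?mulr_ge0 ?le_min ?ltW //; lra.
have cardA : #|A|%:R = q%:R * 'C(n, r)%:R :> rat.
  by rewrite cardsX cardsT card_ord card_Kedges natrM mulrC.
apply/eqP; rewrite eq_le; apply/andP; split.
  rewrite le_min; apply/andP; split.
    have [->|B0] := eqVneq B set0; first by rewrite cards0 (le_trans _ LK) //; lra.
    by rewrite (le_trans (Bf B _ B0)) // Lcount_mono // proj_edges_sub.
  (* Group [B] by underlying edge: each fibre has at most [q] copies, and independence bounds it by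
     [edge_count]. *)
  rewrite -card_Kedges -sum1_card (partition_big fst (mem K)) /=; last first.
    by move=> x /(subsetP BA); rewrite inE => /andP[].
  rewrite natr_sum mulr_natr -sumr_const; apply: ler_sum => e eK.
  rewrite sum1dep_card; set C := [set x | _].
  have Csub : C \subset setX [set e] [set: 'I_q].
    by apply/subsetP => x; rewrite !inE andbT => /andP[].
  have := subset_leq_card Csub; rewrite cardsX cards1 mul1n cardsT card_ord => Cq.
  rewrite le_min ler_nat Cq /=.
  have [->|C0] := eqVneq C set0; first by rewrite cards0; lra.
  have CB : C \subset B by apply/subsetP => x; rewrite inE => /andP[].
  rewrite (le_trans (Bf C CB C0)) // -(Lcount_edge e eK) Lcount_mono //.
  exact: proj_edges_sub.
pose f C := Lcount b (proj_edges C).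
(* Uniform weight on the [q * 'C(n, r)] copies, of total [M]. *)
pose c := M / (q%:R * 'C(n, r)%:R).
have qN0 : 0 < q%:R * 'C(n, r)%:R :> rat by rewrite mulr_gt0.
have -> : M = c * #|A|%:R by rewrite cardA divfK // gt_eqF.
apply: (maximal_bounded_card _ f) => //.
- by move=> C; apply: Lcount_int.
- by move=> C D CD; apply: Lcount_mono; apply: imsetS.
- move=> C D; apply: le_trans (Lcount_submod _ _); rewrite /f /proj_edges imsetU lerD2l.
  by apply: Lcount_mono; rewrite subsetI !imsetS ?subsetIl ?subsetIr.
- by rewrite divr_ge0 ?(ltW qN0) //= ler_pdivrMr // mul1r.
- by move=> x; rewrite inE => /andP[xK _]; rewrite /f proj_edges1 Lcount_edge.
move=> C CA C0; rewrite /c mulrAC ler_pdivrMr //.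
have P0 : proj_edges C != set0.
  by have /set0Pn[x xC] := C0; apply/set0Pn; exists x.1; apply: imset_f.
have lowP := Lcount_lower _ _ P0 (proj_edges_sub _ _ CA) MK Mp.
(* As [f] sees only the projection, the worst case for [C] is to contain all copies of its edges. *)
have cardC : #|C|%:R <= q%:R * #|proj_edges C|%:R :> rat.
  have -> : q%:R * #|proj_edges C|%:R = #|copies q (proj_edges C)|%:R :> rat.
    by rewrite cardsX cardsT card_ord natrM mulrC.
  rewrite ler_nat subset_leq_card //.
  by apply/subsetP => x xC; rewrite !inE andbT; apply: imset_f.
apply: (@le_trans _ _ (q%:R * (#|proj_edges C|%:R * M))).
  by rewrite mulrA mulrC ler_wpM2r.
by rewrite [leRHS]mulrCA ler_wpM2l ?(ltW q0') // [leRHS]mulrC.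
Qed.
End CountFunction.

(** * Dividing the rank by the common denominator *)

(** The cases are split by the sign of [L K]: a rank is nonnegative, whereas the minimum is negative
    when [L K < 0]. *)
Theorem theorem4p20 (r n : nat) (hr : (1 <= r)%N) (hn : (1 <= n)%N)
    (a : 'I_r.+1 -> rat)
    (ha : forall i : 'I_r.+1, (1 <= i)%N -> 0 <= a i) :
  let p := a ord0 + \sum_(i < r.+1 | (0 < i)%N) a i * 'C(r, i)%:R in
  (0 <= Lcount a (Kedges n r) ->
    count_rho a (Kedges n r) =
      Num.min (Lcount a (Kedges n r))
              (Num.min 1 (Num.max 0 p) * 'C(n, r)%:R)) /\
  (Lcount a (Kedges n r) < 0 -> count_rho a (Kedges n r) = 0).
Proof.
move=> p; rewrite /count_rho; set q := denom a; set b := fun i => q%:R * a i.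
have /andP[q0 /forallP b_int] : clears_denoms a q.
  by rewrite /q /denom; case: ex_minnP.
have q0' : 0 < q%:R :> rat by rewrite ltr0n.
have b_ge0 (i : 'I_r.+1) : (1 <= i)%N -> 0 <= b i.
  by move=> i1; rewrite mulr_ge0 ?ler0n ?ha.
have bE (x : 'I_r.+1 -> nat) : b ord0 + \sum_(i < r.+1 | (0 < i)%N) b i * (x i)%:R =
    q%:R * (a ord0 + \sum_(i < r.+1 | (0 < i)%N) a i * (x i)%:R).
  by rewrite mulrDr mulr_sumr; congr (_ + _); apply: eq_bigr => i _; rewrite mulrA.
have pE := bE (fun i => 'C(r, i)); rewrite -/p in pE.
have LE : Lcount b (Kedges n r) = q%:R * Lcount a (Kedges n r) := bE _.
have [nr|rn] := ltnP n r.
  rewrite (count_rank_eq0 _ _ _ _ (or_introl nr)) mul0r bin_small // mulr0; split=> //.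
  by move=> L0; rewrite min_r.
have [p0|p0] := leP p 0.
  have b1 : q%:R * p < 1 by apply: le_lt_trans ltr01; rewrite pmulr_rle0.
  rewrite -pE in b1.
  rewrite (count_rank_eq0 _ _ _ _ (or_intror b1)) mul0r; split=> // L0.
  by rewrite (min_r ler01) mul0r min_r.
(* A positive integer is at least [1]; this makes single copies independent. *)
have b1 : 1 <= q%:R * p.
  have : q%:R * p \is a Num.int.
    rewrite -pE rpredD ?b_int // rpred_sum // => i _.
    by rewrite rpredM ?b_int // natr_int.
  move=> /intrP[z pz]; have : 0 < q%:R * p by rewrite mulr_gt0.
  by rewrite pz ltr0z ler1z; lia.
(* With [0 < p] this rules out the negative case. *)
have Lp : p <= Lcount a (Kedges n r).
  have /card_gt0P[e eK] : (0 < #|Kedges n r|)%N by rewrite card_Kedges bin_gt0.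
  by rewrite /p -(Lcount_edge _ _ a e eK) Lcount_mono ?sub1set.
split; last by lra.
move=> _; rewrite count_rank_Kedges ?pE // LE.
rewrite -[in Num.min q%:R](mulr1 q%:R) -minr_pMr ?ltW // -mulrA -minr_pMr ?ltW //.
by rewrite mulrC mulKf // gt_eqF.
Qed.
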